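(* Let $N\ge 1$ and let $f$ be a TFPL of size $N$. Then $\mathrm{WL}^{2N-1}(f)$ is stable, so that for all $m\geq 2N-1$ $$\mathrm{WL}^m(f)=\mathrm{WL}^{2N-1}(f).$$ The same holds for right-Wieland gyration: $\mathrm{WR}^{2N-1}(f)$ is invariant under $\mathrm{WR}$, so that $\mathrm{WR}^m(f)=\mathrm{WR}^{2N-1}(f)$ for all $m\ge 2N-1$.
   Context: The graph $G^N$ ($N\ge1$): the induced subgraph of the square grid made up of $N$ consecutive centered rows of $3,5,\dots,2N+1$ vertices from top to bottom, together with $2N+1$ vertical external edges hanging down from the $2N+1$ vertices of the bottom row (their lower endpoints are not counted as vertices). $\mathcal{L}^N=\{L_1,\dots,L_N\}$ (resp. $\mathcal{R}^N=\{R_1,\dots,R_N\}$) is the set of leftmost (resp. rightmost) vertices of the rows, numbered from left to right; so $L_1$ and $R_N$ lie in the bottom row, $L_N$ and $R_1$ in the top row. The cells of $G^N$ are its $N(N+1)$ unit squares, including the $2N$ external squares below the bottom row, each of which has only three surrounding edges (top, left, right). Cells are partitioned chessboard-wise into odd and even cells, the top left cell being odd. A TFPL (triangular fully packed loop configuration) of size $N$ is a subgraph $f$ of $G^N$ such that: (i) exactly every other external edge, starting with the second from the left, belongs to $f$; (ii) the vertices in $\mathcal{L}^N\cup\mathcal{R}^N$ have degree 0 or 1; (iii) all other vertices of $G^N$ have degree 2; (iv) no path in $f$ connects two vertices of $\mathcal{L}^N$ or two vertices of $\mathcal{R}^N$. Wieland gyration of a cell: if the cell contains precisely two edges of the configuration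 and these lie on opposite sides, it is unchanged; otherwise edges and non-edges among its surrounding edges are exchanged. Left-Wieland gyration $\mathrm{WL}(f)$ of a TFPL $f$: (1) insert a vertex $L_i'$ to the left of $L_i$ for all $i$, and add a horizontal edge between $L'_i$ and $L_i$ for every $i$ such that $L_i$ has degree 1 in $f$; (2) apply Wieland gyration to each odd cell of $f$; (3) delete all vertices in $\mathcal{R}^N$ and their incident edges; finally shift everything one unit to the right. Right-Wieland gyration $\mathrm{WR}(f)$ is the mirror image: (1) insert a vertex $R_i'$ to the right of $R_i$ for all $i$, and add a horizontal edge between $R_i$ and $R_i'$ for every $i$ such that $R_i$ has degree 1 in $f$; (2) apply Wieland gyration to each even cell of $f$; (3) delete all vertices in $\mathcal{L}^N$ and their incident edges; finally shift everything one unit to the left. Both maps send TFPLs of size $N$ to TFPLs of size $N$; $\mathrm{WL}^m$, $\mathrm{WR}^m$ denote $m$-fold iterates. A TFPL $f$ is stable if $\mathrm{WL}(f)=f$. *)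

(* Defs.v *)
From mathcomp Require Import all_boot all_order all_algebra.
From mathcomp Require Import finmap.

Set Implicit Arguments.
Unset Strict Implicit.
Unset Printing Implicit Defensive.

Import GRing.Theory Num.Theory.

Local Open Scope fset_scope.
Local Open Scope ring_scope.

(* The point (x, y) of the square grid lies in column x (increasing to the
   right, 0 being the column of symmetry of G^N) and in row y (increasing
   downwards, 1 being the top row of G^N). *)
Definition point : Type := (int * nat)%type.

(* (false, (x, y)) is the horizontal edge joining (x, y) to (x + 1, y);
   (true, (x, y)) is the vertical edge joining (x, y) to (x, y + 1). *)
Definition edge : Type := (bool * (int * nat))%type.

Definition hedge (x : int) (y : nat) : edge := (false, (x, y)).
Definition vedge (x : int) (y : nat) : edge := (true, (x, y)).

Definition fst_end (e : edge) : point := e.2.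
Definition snd_end (e : edge) : point :=
  if e.1 then (e.2.1, e.2.2.+1) else (e.2.1 + 1, e.2.2).

Definition incident (v : point) (e : edge) : bool :=
  (v == fst_end e) || (v == snd_end e).

(* A configuration is a set of grid edges; a subgraph of G^N is identified with
   its set of edges, the vertex set always being that of G^N. *)
Definition config : Type := {fset edge}.

Definition is_vertex (N : nat) (v : point) : bool :=
  (0 < v.2 <= N)%N && (absz v.1 <= v.2)%N.

(* The lower endpoint (x, N.+1) of an external edge is not a vertex of G^N. *)
Definition is_external (N : nat) (e : edge) : bool :=
  [&& e.1, e.2.2 == N & is_vertex N (fst_end e)].

Definition is_edge (N : nat) (e : edge) : bool :=
  is_vertex N (fst_end e) && is_vertex N (snd_end e) || is_external N e.

(* L_i and R_i, for 1 <= i <= N. *)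
Definition Lvert (N i : nat) : point := (- (N.+1 - i)%N%:Z, (N.+1 - i)%N).
Definition Rvert (i : nat) : point := (i%:Z, i).

Definition Lset (N : nat) : {fset point} :=
  [fset Lvert N i | i in iota 1 N].
Definition Rset (N : nat) : {fset point} :=
  [fset Rvert i | i in iota 1 N].

(* At a vertex of G^N the incident external edge is counted. *)
Definition degree (f : config) (v : point) : nat :=
  #|` [fset e in f | incident v e]|.

Definition adjacent (N : nat) (f : config) : rel point := fun u v =>
  [&& is_vertex N u, is_vertex N v
    & has (fun e => ((u == fst_end e) && (v == snd_end e))
                 || ((v == fst_end e) && (u == snd_end e))) f].

Definition connected_by_path (N : nat) (f : config) (u v : point) : Prop :=
  exists p : seq point,
    [/\ path (adjacent N f) u p, uniq (u :: p) & last u p = v].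

Record tfpl (N : nat) (f : config) : Prop := Tfpl {
  tfpl_sub : forall e, e \in f -> is_edge N e;
  (* (k - N, N) is the k-th vertex of the bottom row, counted from 0 *)
  tfpl_external : forall k : nat, (k <= N.*2)%N ->
    (vedge (k%:Z - N%:Z) N \in f) = odd k;
  tfpl_boundary : forall v, v \in Lset N `|` Rset N -> (degree f v <= 1)%N;
  tfpl_inner : forall v, is_vertex N v -> v \notin Lset N `|` Rset N ->
    degree f v = 2;
  tfpl_left : forall u v, u \in Lset N -> v \in Lset N -> u != v ->
    ~ connected_by_path N f u v;
  tfpl_right : forall u v, u \in Rset N -> v \in Rset N -> u != v ->
    ~ connected_by_path N f u v
}.

(* A cell is represented by its top left corner. *)
Definition cell : Type := (int * nat)%type.

Definition top_edge (c : cell) : edge := hedge c.1 c.2.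
Definition bottom_edge (c : cell) : edge := hedge c.1 c.2.+1.
Definition left_edge (c : cell) : edge := vedge c.1 c.2.
Definition right_edge (c : cell) : edge := vedge (c.1 + 1) c.2.

(* The cells in row y have top left corners (k - y, y) for 0 <= k < 2 y; those
   in row N are the external ones. *)
Definition cells (N : nat) : seq cell :=
  [seq (k%:Z - y%:Z, y) | y <- iota 1 N, k <- iota 0 y.*2].

(* The top left cell is (-1, 1), and it is odd. *)
Definition odd_cell (c : cell) : bool := ~~ odd (absz (c.1 + c.2%:Z)).

(* An external cell has no bottom edge. *)
Definition cell_edges (N : nat) (c : cell) : config :=
  if c.2 == N then [fset top_edge c; left_edge c; right_edge c]
  else [fset top_edge c; bottom_edge c; left_edge c; right_edge c].

Definition opposite_sides (N : nat) (f : config) (c : cell) : bool :=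
  (cell_edges N c `&` f == [fset top_edge c; bottom_edge c])
  || (cell_edges N c `&` f == [fset left_edge c; right_edge c]).

Definition gyrate (N : nat) (c : cell) (f : config) : config :=
  if opposite_sides N f c then f
  else (f `\` cell_edges N c) `|` (cell_edges N c `\` f).

(* Distinct cells of the same parity share no edge, so that the order in which
   they are treated is irrelevant. *)
Definition gyrate_all (N : nat) (s : seq cell) (f : config) : config :=
  foldr (gyrate N) f s.

Definition insert_left (N : nat) (f : config) : config :=
  f `|` [fset hedge (v.1 - 1) v.2 | v in Lset N & degree f v == 1%N].
Definition insert_right (N : nat) (f : config) : config :=
  f `|` [fset hedge v.1 v.2 | v in Rset N & degree f v == 1%N].

Definition delete_vertices (A : {fset point}) (f : config) : config :=
  [fset e in f | (fst_end e \notin A) && (snd_end e \notin A)].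

Definition shift (d : int) (f : config) : config :=
  [fset ((e.1, (e.2.1 + d, e.2.2)) : edge) | e in f].

Definition WL (N : nat) (f : config) : config :=
  shift 1 (delete_vertices (Rset N)
    (gyrate_all N [seq c <- cells N | odd_cell c] (insert_left N f))).

Definition WR (N : nat) (f : config) : config :=
  shift (- 1) (delete_vertices (Lset N)
    (gyrate_all N [seq c <- cells N | ~~ odd_cell c] (insert_right N f))).

Definition stable (N : nat) (f : config) : Prop := tfpl N f /\ WL N f = f.

(* Main.v *)
Require Import Defs.
From mathcomp Require Import all_boot all_order all_algebra.
From mathcomp Require Import finmap zify.

(* Gyration replaces the contribution d of an odd cell to the degree of one of
   its corners by 2 - d, and it preserves the pairing, inside the cell, of the
   corners with d = 1; since every interior vertex lies on two odd cells, degrees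
   and connectivity survive, so WL maps TFPLs to TFPLs.

   After the final shift, the right edge of an odd cell depends only on the
   columns to its left and, if it is the image of a left edge, on its own former
   state.  In the latter case a look at the possible cells shows that it is frozen
   one step after the columns to its left.  Each horizontal edge is determined, by
   the degree of its left endpoint, by the columns to its left.  So columns freeze
   one after the other from left to right: column k - N is constant from time k
   on, and the rightmost nontrivial one is column N - 1.

   WR is conjugate to WL under reflection in the vertical axis. *)

Set Implicit Arguments.
Unset Strict Implicit.
Unset Printing Implicit Defensive.
Import GRing.Theory Num.Theory Order.TTheory.
Local Open Scope fset_scope.
Local Open Scope ring_scope.

(** * Gyration of the odd cells *)

Lemma mem_cells N c : (c \in cells N) = [&& (0 < c.2 <= N)%N, - (c.2)%:Z <= c.1 & c.1 < c.2%:Z].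
Proof.
rewrite /cells; apply/allpairsPdep/idP => /=.
  case=> [y [k [hy hk ->]]] /=; move: hy hk; rewrite !mem_iota -addnn; lia.
case: c => x y /= h; exists y, (absz (x + y%:Z)%R).
rewrite !mem_iota -addnn; split; [lia|lia|].
congr (_,_); lia.
Qed.

Lemma vertP N x y : is_vertex N (x,y) = (0 < y <= N)%N && (- y%:Z <= x <= y%:Z).
Proof. rewrite /is_vertex /=; lia. Qed.

Lemma mem_Lset N x y : ((x,y) \in Lset N) = (0 < y <= N)%N && (x == - y%:Z).
Proof.
apply/imfsetP/idP => /=.
  case=> i; rewrite mem_iota /Lvert => hi [-> ->]; lia.
move=> h; exists (N.+1 - y)%N; first by rewrite mem_iota; lia.
rewrite /Lvert; congr (_,_); lia.
Qed.

Lemma mem_Rset N x y : ((x,y) \in Rset N) = (0 < y <= N)%N && (x == y%:Z).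
Proof.
apply/imfsetP/idP => /=.
  case=> i; rewrite mem_iota /Rvert => hi [-> ->]; lia.
move=> h; exists y%N; first by rewrite mem_iota; lia.
rewrite /Rvert; congr (_,_); lia.
Qed.

Lemma hedgeE x y x' y' : (hedge x y == hedge x' y') = (x == x') && (y == y').
Proof. by rewrite /hedge !xpair_eqE. Qed.

Lemma vedgeE x y x' y' : (vedge x y == vedge x' y') = (x == x') && (y == y').
Proof. by rewrite /vedge !xpair_eqE. Qed.

Lemma hvedgeE x y x' y' : (hedge x y == vedge x' y') = false.
Proof. by []. Qed.

Lemma vhedgeE x y x' y' : (vedge x y == hedge x' y') = false.
Proof. by []. Qed.
Definition edgeE := (hedgeE, vedgeE, hvedgeE, vhedgeE).

Lemma in_cell_edges N c e : (e \in cell_edges N c) =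
  [|| e == top_edge c, (c.2 != N) && (e == bottom_edge c), e == left_edge c | e == right_edge c].
Proof.
rewrite /cell_edges; by case: (c.2 == N); rewrite !inE /= -?orbA.
Qed.

(** Distinct cells with a common edge are horizontal or vertical neighbours, so the chessboard
    colours them differently. *)
Lemma cell_edges_inj N c d e : odd_cell c = odd_cell d ->
  e \in cell_edges N c -> e \in cell_edges N d -> c = d.
Proof.
case: c d e => [x y] [x' y'] [b [u v]].
rewrite !in_cell_edges /odd_cell /top_edge /bottom_edge /left_edge /right_edge /hedge /vedge.
rewrite !xpair_eqE /= => hp h h'.
suff: (x == x') && (y == y') by move=> /andP[/eqP-> /eqP->].
case: b h h' => /=; move: hp; lia.
Qed.

Lemma in_gyrate N c f e : (e \in gyrate N c f) =
  (e \in f) (+) ((e \in cell_edges N c) && ~~ opposite_sides N f c).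
Proof.
rewrite /gyrate; case: ifP => _; first by rewrite andbF addbF.
by rewrite !inE andbT; case: (_ \in f); case: (_ \in _).
Qed.

Definition one_parity (s : seq cell) := {in s &, forall c d, odd_cell c = odd_cell d}.

(** Cells of one parity have disjoint edge sets: each still sees the original [f] on its own edges
    when its turn comes, and at most one of them toggles a given edge. *)
Lemma in_gyrate_all N s f e : uniq s -> one_parity s ->
  (e \in gyrate_all N s f) =
  (e \in f) (+) has (fun c => (e \in cell_edges N c) && ~~ opposite_sides N f c) s.
Proof.
elim: s e => [|c s IH] e /=; first by rewrite addbF.
case/andP=> cs us par.
have par' : one_parity s by move=> d d' hd hd'; apply: par; rewrite inE ?hd ?hd' orbT.
have nhas e' : e' \in cell_edges N c -> has (fun d =>
  (e' \in cell_edges N d) && ~~ opposite_sides N f d) s = false.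
  move=> he; apply/negbTE/hasPn => d hd; rewrite negb_and; apply/orP; left; apply/negP => he'.
  move: cs; rewrite (cell_edges_inj _ he he') ?hd //.
  by apply: par; rewrite inE ?eqxx ?hd ?orbT.
have opE : opposite_sides N (gyrate_all N s f) c = opposite_sides N f c.
  rewrite /opposite_sides; suff -> :
    cell_edges N c `&` gyrate_all N s f = cell_edges N c `&` f by [].
  apply/fsetP => e'; rewrite !inE; case he: (e' \in cell_edges N c) => //=.
  by rewrite IH // nhas // addbF.
rewrite -/(gyrate_all N s f) in_gyrate opE IH //.
case he: (e \in cell_edges N c) => /=; last by rewrite addbF.
by rewrite nhas // addbF orbF.
Qed.

Lemma uniq_cells N : uniq (cells N).
Proof.
apply: allpairs_uniq_dep => [|y _|]; rewrite ?iota_uniq //.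
move=> [y k] [y' k'] _ _ /= [] h e2.
have -> : k = k' by move: h; rewrite e2; lia.
by rewrite e2.
Qed.

Lemma opposite_inner N f x y : (y < N)%N -> opposite_sides N f (x, y) =
  let: t := hedge x y \in f in let: b := hedge x y.+1 \in f in
  let: l := vedge x y \in f in let: r := vedge (x + 1) y \in f in
  [&& t == b, l == r & t != l].
Proof.
move=> hy /=.
have E e : e \in cell_edges N (x, y) `&` f = ([|| e == hedge x y, e == hedge x y.+1,
  e == vedge x y | e == vedge (x+1) y]) && (e \in f).
  by rewrite inE in_cell_edges /= ltn_eqF.
rewrite /opposite_sides /top_edge /bottom_edge /left_edge /right_edge /=.
apply/idP/idP.
  case/orP=> /eqP/fsetP H.
    move: (H (hedge x y)) (H (hedge x y.+1)) (H (vedge x y)) (H (vedge (x + 1) y)).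
    rewrite !E !inE !edgeE !eqxx /= ?orbT /=.
    by do 4!case: (_ \in f) => //=.
  move: (H (hedge x y)) (H (hedge x y.+1)) (H (vedge x y)) (H (vedge (x + 1) y)).
  rewrite !E !inE !edgeE !eqxx /= ?orbT /=.
  by do 4!case: (_ \in f) => //=.
case ht: (hedge x y \in f); case hb: (hedge x y.+1 \in f) => //;
 case hl: (vedge x y \in f); case hr: (vedge (x + 1) y \in f) => // _; apply/orP; [left|right];
 apply/eqP/fsetP => e; rewrite E !inE;
 (case: (eqVneq e (hedge x y)) => [->|_]; first by rewrite ?ht ?edgeE);
 (case: (eqVneq e (hedge x y.+1)) => [->|_]; first by rewrite ?hb ?edgeE ?andbT ?andbF /= ?eqxx);
 (case: (eqVneq e (vedge x y)) => [->|_]; first by rewrite ?hl);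
 (case: (eqVneq e (vedge (x+1) y)) => [->|_]; first by rewrite ?hr) => //.
Qed.

(** The horizontal pattern would need the missing bottom edge, and the vertical one is excluded
    because just one vertical side is present. Since the external edges of a TFPL alternate,
    external cells always exchange. *)
Lemma opposite_external N f x y : y = N -> (vedge x y \in f) != (vedge (x + 1) y \in f) ->
  opposite_sides N f (x, y) = false.
Proof.
move=> hy h; apply/negbTE/negP.
have E e : e \in cell_edges N (x, y) `&` f = ([|| e == hedge x y,
  e == vedge x y | e == vedge (x+1) y]) && (e \in f).
  by rewrite inE in_cell_edges /= hy eqxx.
by rewrite /opposite_sides /top_edge /bottom_edge /left_edge /right_edge /= => /orP[] /eqP/fsetP H;
  move: (H (vedge x y)) (H (vedge (x + 1) y)) (H (hedge x y)) (H (hedge x y.+1)) h;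
  rewrite !E !inE !edgeE !eqxx /= ?orbT /= ?(gtn_eqF (ltnSn y)) ?andbF /=;
  do 3!case: (_ \in f) => //=.
Qed.

(** The state after gyration but before the deletion of the right boundary, in the coordinates
    before the shift. *)
Definition gyr (N : nat) (f : config) : config :=
  gyrate_all N [seq c <- cells N | odd_cell c] (insert_left N f).

(* Whether gyration fixes the internal cell with top left corner [(x, y)]. *)
Definition neutral (f : config) (x : int) (y : nat) : bool :=
  [&& (hedge x y \in f) == (hedge x y.+1 \in f),
      (vedge x y \in f) == (vedge (x + 1) y \in f)
    & (hedge x y \in f) != (vedge x y \in f)].

Lemma degreeE f (x : int) (y : nat) : (0 < y)%N -> degree f (x, y) =
  ((hedge x y \in f) + (hedge (x - 1) y \in f) + (vedge x y \in f) + (vedge x y.-1 \in f))%N.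
Proof.
move=> hy; pose s := [:: hedge x y; hedge (x - 1) y; vedge x y; vedge x y.-1].
(* For [y = 0] the truncated [y.-1] would list the edge below the vertex twice. *)
have us : uniq s.
  rewrite /s /= !inE !edgeE /=; lia.
have -> : degree f (x, y) = size [seq e <- s | e \in f].
  rewrite -(undup_id (filter_uniq _ us)) -(size_seq_fset tt) /degree; congr size; congr enum_fset.
  apply/fsetP => -[b [u v]]; rewrite seq_fsetE mem_filter !inE /=; congr (_ && _).
  rewrite /incident /fst_end /snd_end /hedge /vedge !xpair_eqE /=; case: b; rewrite /= !xpair_eqE;
    lia.
by rewrite size_filter /= addn0 !addnA.
Qed.

Lemma hedge_in N f (x : int) (y : nat) : tfpl N f -> hedge x y \in f ->
  (0 < y <= N)%N && (- y%:Z <= x < y%:Z).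
Proof. case=> h _ _ _ _ _ /h; rewrite /is_edge /is_external /fst_end /snd_end /= !vertP; lia. Qed.

Lemma vedge_in N f (x : int) (y : nat) : tfpl N f -> vedge x y \in f ->
  (0 < y <= N)%N && (- y%:Z <= x <= y%:Z).
Proof. case=> h _ _ _ _ _ /h; rewrite /is_edge /is_external /fst_end /snd_end /= !vertP; lia. Qed.

Lemma vedge_ext N f x : tfpl N f -> - N%:Z <= x <= N%:Z ->
  (vedge x N \in f) = odd (absz (x + N%:Z)).
Proof.
case=> _ h _ _ _ _ hx; rewrite -h; last by lia.
by congr (_ \in f); congr vedge; lia.
Qed.

Lemma degree_L N f y : tfpl N f -> (0 < y <= N)%N ->
  degree f (- y%:Z, y) = ((hedge (- y%:Z)%R y \in f) + (vedge (- y%:Z)%R y \in f))%N.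
Proof.
move=> hf hy; rewrite degreeE; last by lia.
have -> : hedge (- y%:Z - 1) y \in f = false by apply/negP => /(hedge_in hf); lia.
have -> : vedge (- y%:Z) y.-1 \in f = false by apply/negP => /(vedge_in hf); lia.
by rewrite !addn0.
Qed.

Lemma degree_L_le1 N f y : tfpl N f -> (0 < y <= N)%N -> (degree f ((- y%:Z)%R, y) <= 1)%N.
Proof. by case=> _ _ h _ _ _ hy; apply: h; rewrite inE mem_Lset hy eqxx. Qed.

Lemma in_insert_left N f b (x : int) (y : nat) : ((b, (x, y)) \in insert_left N f) =
  ((b, (x, y)) \in f) || [&& ~~ b, (0 < y <= N)%N, x == - y%:Z - 1 & degree f (- y%:Z, y) == 1%N].
Proof.
rewrite /insert_left inE; congr (_ || _); apply/imfsetP/idP => /=.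
  case=> -[u v]; rewrite !inE mem_Lset /= => /andP[/andP[h /eqP->] hd] [-> -> ->]; rewrite h hd /=;
    lia.
case/and4P=> /negbTE-> hy /eqP-> hd; exists (- y%:Z, y) => //=.
by rewrite !inE mem_Lset hy eqxx.
Qed.

(** The inserted edge of a row lies to the left of every cell that touches this row. *)
Lemma insert_cell N f c e : c \in cells N -> e \in cell_edges N c ->
  (e \in insert_left N f) = (e \in f).
Proof.
case: c e => x y [b [u v]]; rewrite mem_cells in_cell_edges in_insert_left /= => hc.
rewrite /top_edge /bottom_edge /left_edge /right_edge /hedge /vedge !xpair_eqE /= => he.
rewrite orbC; case: eqP => //= hu; last by rewrite !andbF.
case: b he => //= he; suff -> : (0 < v <= N)%N = false by [].
lia.
Qed.

Lemma in_gyr_cell N f c e : c \in cells N -> odd_cell c -> e \in cell_edges N c ->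
  (e \in gyr N f) = (e \in f) (+) ~~ opposite_sides N f c.
Proof.
move=> hc oc he.
rewrite /gyr in_gyrate_all ?filter_uniq ?uniq_cells //; last first.
  by move=> d d'; rewrite !mem_filter => /andP[-> _] /andP[-> _].
rewrite (insert_cell _ hc he); congr (_ (+) _).
have opE : opposite_sides N (insert_left N f) c = opposite_sides N f c.
  rewrite /opposite_sides; suff -> :
    cell_edges N c `&` insert_left N f = cell_edges N c `&` f by [].
  by apply/fsetP => e'; rewrite !in_fsetI; case he': (_ \in cell_edges N c) => //=; apply:
    insert_cell he'.
rewrite -opE; apply/hasP/idP => [[d]|ho].
  by rewrite mem_filter => /andP[od hd] /andP[he' ho]; rewrite (@cell_edges_inj N c d e) ?oc ?od.
by exists c; rewrite ?mem_filter ?oc ?hc // he.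
Qed.

Lemma in_gyr_nocell N f e : (forall c, c \in cells N -> odd_cell c -> e \notin cell_edges N c) ->
  (e \in gyr N f) = (e \in insert_left N f).
Proof.
move=> h; rewrite /gyr in_gyrate_all ?filter_uniq ?uniq_cells //; last first.
  by move=> d d'; rewrite !mem_filter => /andP[-> _] /andP[-> _].
rewrite (_ : has _ _ = false) ?addbF //; apply/negbTE/hasPn => c.
by rewrite mem_filter => /andP[oc hc]; rewrite (negbTE (h _ hc oc)).
Qed.

Lemma in_gyr_inner N f (x : int) (y : nat) e : (0 < y < N)%N -> - y%:Z <= x < y%:Z ->
  ~~ odd (absz (x + y%:Z)) ->
  e \in [:: hedge x y; hedge x y.+1; vedge x y; vedge (x + 1) y] ->
  (e \in gyr N f) = (e \in f) (+) ~~ neutral f x y.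
Proof.
move=> hy hx px he; rewrite (@in_gyr_cell N f (x, y)) //.
- by rewrite opposite_inner //; lia.
- by rewrite mem_cells /=; lia.
- rewrite in_cell_edges /= (_ : y != N) /=; last by lia.
  by move: he; rewrite !inE.
Qed.

Lemma in_gyr_external N f x e : tfpl N f -> (0 < N)%N -> - N%:Z <= x < N%:Z ->
  ~~ odd (absz (x + N%:Z)) ->
  e \in [:: hedge x N; vedge x N; vedge (x + 1) N] ->
  (e \in gyr N f) = ~~ (e \in f).
Proof.
move=> hf hN hx px he; rewrite (@in_gyr_cell N f (x, N)) //.
- rewrite (@opposite_external N f x N) ?addbT //.
  rewrite !(vedge_ext hf) //; lia.
- by rewrite mem_cells /=; lia.
- by rewrite in_cell_edges /= eqxx /=; move: he; rewrite !inE.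
Qed.

Lemma in_gyr_L N f y : tfpl N f -> (0 < y <= N)%N ->
  (hedge (- y%:Z - 1) y \in gyr N f) = (degree f (- y%:Z, y) == 1%N).
Proof.
move=> hf hy; rewrite in_gyr_nocell.
  rewrite in_insert_left hy eqxx /=; case: (boolP (_ \in f)) => // /(hedge_in hf); lia.
move=> [u v]; rewrite mem_cells in_cell_edges /odd_cell.
rewrite /top_edge /bottom_edge /left_edge /right_edge !edgeE /=; lia.
Qed.

(** The square below the last edge of a row is even and the one above it is not a cell, so the odd
    cells leave this edge alone. *)
Lemma in_gyr_Rh N f y : (0 < y)%N ->
  (hedge (y%:Z - 1) y \in gyr N f) = (hedge (y%:Z - 1) y \in f).
Proof.
move=> hy; rewrite in_gyr_nocell.
  by rewrite in_insert_left /= (_ : _ == _ = false) ?andbF ?orbF //; lia.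
move=> [u v]; rewrite mem_cells in_cell_edges /odd_cell.
rewrite /top_edge /bottom_edge /left_edge /right_edge !edgeE /=; lia.
Qed.

Lemma in_gyr_Rv N f y : (vedge y%:Z y \in gyr N f) = (vedge y%:Z y \in f).
Proof.
rewrite in_gyr_nocell; first by rewrite in_insert_left /= orbF.
move=> [u v]; rewrite mem_cells in_cell_edges /odd_cell.
rewrite /top_edge /bottom_edge /left_edge /right_edge !edgeE /=; lia.
Qed.

Lemma gyr_hedge_in N f (x : int) (y : nat) : tfpl N f -> hedge x y \in gyr N f ->
  (0 < y <= N)%N && (- y%:Z - 1 <= x < y%:Z).
Proof.
move=> hf; case h: ((0 < y <= N)%N && (- y%:Z - 1 <= x < y%:Z)) => //.
rewrite in_gyr_nocell.
  rewrite in_insert_left /= => /orP[/(hedge_in hf)|]; move: h; lia.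
move=> [u v]; rewrite mem_cells in_cell_edges /odd_cell.
rewrite /top_edge /bottom_edge /left_edge /right_edge !edgeE /=; lia.
Qed.

Lemma gyr_vedge_in N f (x : int) (y : nat) : tfpl N f -> vedge x y \in gyr N f ->
  (0 < y <= N)%N && (- y%:Z <= x <= y%:Z).
Proof.
move=> hf; case h: ((0 < y <= N)%N && (- y%:Z <= x <= y%:Z)) => //.
rewrite in_gyr_nocell.
  rewrite in_insert_left /= orbF => /(vedge_in hf); move: h; lia.
move=> [u v]; rewrite mem_cells in_cell_edges /odd_cell.
rewrite /top_edge /bottom_edge /left_edge /right_edge !edgeE /=; lia.
Qed.

Lemma in_shift d f b (x : int) (y : nat) : ((b, (x, y)) \in shift d f) = ((b, (x - d, y)) \in f).
Proof.
apply/imfsetP/idP => /= [[[b' [u v]] h [-> -> ->]]|h] /=; first by rewrite addrK.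
by exists (b, (x - d, y)) => //=; rewrite subrK.
Qed.

Lemma in_WL N f e : ((e.1, (e.2.1 + 1, e.2.2)) \in WL N f) =
  [&& e \in gyr N f, fst_end e \notin Rset N & snd_end e \notin Rset N].
Proof.
by case: e => b [x y] /=; rewrite /WL in_shift addrK !inE.
Qed.

Lemma in_WL_h N f (x : int) (y : nat) : (hedge (x + 1) y \in WL N f) =
  (hedge x y \in gyr N f) && ~~ ((0 < y <= N)%N && ((x == y%:Z) || (x + 1 == y%:Z))).
Proof. by rewrite (in_WL N f (hedge x y)) /fst_end /snd_end /= !mem_Rset; congr (_ && _); lia. Qed.

Lemma in_WL_v N f (x : int) (y : nat) : (vedge (x + 1) y \in WL N f) =
  (vedge x y \in gyr N f) && ~~ ((0 < y <= N)%N && (x == y%:Z) || (y < N)%N && (x == y.+1%:Z)).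
Proof. by rewrite (in_WL N f (vedge x y)) /fst_end /snd_end /= !mem_Rset; congr (_ && _); lia. Qed.

(** * Degrees and paths *)

Lemma degree_inner N f (x : int) (y : nat) : tfpl N f -> (0 < y <= N)%N -> - y%:Z < x < y%:Z ->
  degree f (x, y) = 2%N.
Proof. by case=> _ _ _ h _ _ hy hx; apply: h; rewrite ?vertP ?inE ?mem_Lset ?mem_Rset; lia. Qed.

(** Walks that may revisit vertices can be concatenated; shortening them recovers simple paths. *)
Definition conn (N : nat) (f : config) (u v : point) : Prop :=
  exists2 p, path (adjacent N f) u p & last u p = v.

Lemma conn_path N f u v : connected_by_path N f u v <-> conn N f u v.
Proof.
split=> [[p [hp _ hl]]|[p hp hl]]; first by exists p.
case: (shortenP hp) hl => p' hp' up' _ hl; by exists p'.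
Qed.

Lemma conn_refl N f u : conn N f u u.
Proof. by exists [::]. Qed.

Lemma conn_trans N f v u w : conn N f u v -> conn N f v w -> conn N f u w.
Proof.
case=> p hp hl [q hq hl']; exists (p ++ q); first by rewrite cat_path hp hl.
by rewrite last_cat hl.
Qed.

Lemma adjacent_sym N f : symmetric (adjacent N f).
Proof.
move=> u v; rewrite /adjacent [is_vertex N u && _]andbCA; congr [&& _, _ & _].
by apply: eq_has => e; rewrite orbC.
Qed.

Lemma conn1 N f u v : adjacent N f u v -> conn N f u v.
Proof. by move=> h; exists [:: v] => //=; rewrite h. Qed.

Lemma conn_sym N f u v : conn N f u v -> conn N f v u.
Proof.
case=> p; elim: p u => [|w p IH] u /=; first by move=> _ ->; exact: conn_refl.
case/andP=> h hp hl; apply: conn_trans (IH w hp hl) _.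
by apply: conn1; rewrite adjacent_sym.
Qed.

Lemma conn_hedge N f (x : int) (y : nat) : tfpl N f -> hedge x y \in f -> conn N f (x, y) (x + 1,
  y).
Proof.
move=> hf h; apply: conn1; rewrite /adjacent !vertP; have hb := hedge_in hf h.
apply/and3P; split; [lia|lia|].
by apply/hasP; exists (hedge x y) => //; rewrite /fst_end /snd_end /= !eqxx.
Qed.

Lemma conn_vedge N f (x : int) (y : nat) : tfpl N f -> (y < N)%N -> vedge x y \in f -> conn N f (x,
  y) (x, y.+1).
Proof.
move=> hf hy h; apply: conn1; rewrite /adjacent !vertP; have hb := vedge_in hf h.
apply/and3P; split; [lia|lia|].
by apply/hasP; exists (vedge x y) => //; rewrite /fst_end /snd_end /= !eqxx.
Qed.

(** * Contributions of odd cells to degrees *)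

Definition corner (c : cell) (i j : bool) : point := (c.1 + (i : nat)%:Z, (c.2 + j)%N).

(** The part of the degree of a corner that comes from the square [c]; [i] selects the right side
    and [j] the bottom. *)
Definition contr (F : config) (c : cell) (i j : bool) : nat :=
  ((hedge c.1 (c.2 + j)%N \in F) + (vedge (c.1 + (i : nat)%:Z) c.2 \in F))%N.

(** The odd one of the two squares below or above [w]; the parity of the coordinate sum of [w]
    decides whether it lies to the left or to the right. *)
Definition side_cell (w : point) (j : bool) : cell :=
  (w.1 - ((odd (absz (w.1 + w.2%:Z)) (+) j) : nat)%:Z, (w.2 - j)%N).

(* The two edges at [w] in the odd cell below [w] ([j = false]) or above [w] ([j = true]). *)
Definition side (F : config) (w : point) (j : bool) : nat :=
  contr F (side_cell w j) (odd (absz (w.1 + w.2%:Z)) (+) j) j.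

Lemma side_corner F c i j : odd_cell c -> side F (corner c i j) j = contr F c i j.
Proof.
case: c => x y; rewrite /odd_cell /= => pc; rewrite /side /side_cell /=.
have -> : odd (absz (x + (i : nat)%:Z + (y + j)%N%:Z)) (+) j = i by case: i; case: j => /=; lia.
by rewrite addrK addnK.
Qed.

Lemma odd_side_cell w j : (0 < w.2)%N -> odd_cell (side_cell w j).
Proof. case: w => x y /= hy; rewrite /odd_cell /=; case: j; case:
  (boolP (odd (absz (x + y%:Z)))) => /=; lia. Qed.

(** The two odd squares at a vertex are diagonally opposite, so each of the four grid edges there
    bounds exactly one of them. *)
Lemma degree_side F w : (0 < w.2)%N -> degree F w = (side F w false + side F w true)%N.
Proof.
case: w => x y /= hy; rewrite degreeE // /side /contr /side_cell /= subn0 addn0 subn1.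
rewrite addn1 prednK //.
have x1 : x - 1%Z = x - 1 by [].
by case: (odd _) => /=; rewrite ?subr0 ?addr0 ?subrK ?x1; lia.
Qed.

(** An exchange complements both edges at the corner; a fixed internal cell has exactly one edge at
    each corner, and 1 = 2 - 1. The bound on [c.2 + j] leaves out the lower corners of external
    cells. *)
Lemma gyr_contr N f c (i j : bool) : tfpl N f -> c \in cells N -> odd_cell c -> (c.2 + j <= N)%N ->
  (contr f c i j + contr (gyr N f) c i j = 2)%N.
Proof.
case: c => x y hf; rewrite mem_cells /odd_cell /contr /= => hc pc hj.
case: (ltnP y N) => hy.
  rewrite !(@in_gyr_inner N f x y) //; try lia.
  - rewrite /neutral; case: i; case: j {hj}; rewrite /= ?addr0 ?addn0 ?addn1;
    by do 4!case: (_ \in f).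
  - by case: i; rewrite ?addr0 !inE ?eqxx ?orbT.
  - by case: j {hj}; rewrite ?addn0 ?addn1 !inE ?eqxx ?orbT.
have yN : y = N by lia.
have -> : j = false by case: j hj => //; lia.
rewrite addn0 yN !(@in_gyr_external N f x) //; try lia.
- by do 2!case: (_ \in f).
- by case: i; rewrite ?addr0 !inE ?eqxx ?orbT.
- by rewrite !inE ?eqxx ?orbT.
Qed.

Lemma side_lower N f (x : int) (y : nat) : tfpl N f -> (0 < y <= N)%N -> - y%:Z <= x < y%:Z ->
  (side f (x, y) false + side (gyr N f) (x, y) false = 2)%N.
Proof.
move=> hf hy hx; apply: gyr_contr => //=.
- by rewrite mem_cells /side_cell /=; case: (boolP (odd _)) => /=; lia.
- by apply: odd_side_cell => /=; lia.
- by lia.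
Qed.

(** At the two excluded columns [- y] and [y - 1] the odd square above the vertex is not a cell. *)
Lemma side_upper N f (x : int) (y : nat) : tfpl N f -> (0 < y <= N)%N -> - y%:Z < x < y%:Z - 1 ->
  (side f (x, y) true + side (gyr N f) (x, y) true = 2)%N.
Proof.
move=> hf hy hx; apply: gyr_contr => //=.
- by rewrite mem_cells /side_cell /=; case: (boolP (odd _)) => /=; lia.
- by apply: odd_side_cell => /=; lia.
- by lia.
Qed.

(** The odd square above L_y lies outside the graph; of its two edges at L_y only the inserted one
    can be present. *)
Lemma side_upper_L N f y : tfpl N f -> (0 < y <= N)%N ->
  side (gyr N f) (- y%:Z, y) true = (degree f (- y%:Z, y) == 1%N).
Proof.
move=> hf hy; rewrite /side /contr /side_cell /= (_ : odd _ = false); last by lia.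
rewrite subnK /=; last by lia.
rewrite in_gyr_L // subrK (_ : vedge _ _ \in _ = false) ?addn0 //.
by apply/negP => /(gyr_vedge_in hf); lia.
Qed.

Lemma side_L N f y : tfpl N f -> (0 < y <= N)%N -> side f (- y%:Z, y) true = 0%N.
Proof.
move=> hf hy; rewrite /side /contr /side_cell /= (_ : odd _ = false); last by lia.
rewrite subnK /=; last by lia.
rewrite subrK; apply/eqP; rewrite addn_eq0; apply/andP; split; rewrite eqb0; apply/negP.
  by move/(hedge_in hf); lia.
by move/(vedge_in hf); lia.
Qed.

Lemma side_upper_RE F y : (0 < y)%N ->
  side F (y%:Z - 1, y) true = ((hedge (y%:Z - 1) y \in F) + (vedge (y.-1%:Z) y.-1 \in F))%N.
Proof.
move=> hy; rewrite /side /contr /side_cell /= (_ : odd _ = true); last by lia.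
by rewrite subnK //= subr0 addr0 subn1 (_ : y%:Z - 1 = y.-1%:Z) //; lia.
Qed.

Lemma side_upper_R N f y : (0 < y)%N ->
  side (gyr N f) (y%:Z - 1, y) true = side f (y%:Z - 1, y) true.
Proof. by move=> hy; rewrite !side_upper_RE // in_gyr_Rh // in_gyr_Rv. Qed.

(** Both edges together would form a path between the right boundary vertices of rows [y] and
    [y.-1]. *)
Lemma side_R_le1 N f y : tfpl N f -> (0 < y <= N)%N -> (side f ((y%:Z - 1)%R, y) true <= 1)%N.
Proof.
move=> hf hy; rewrite side_upper_RE; last by lia.
case h1: (_ \in f); case h2: (_ \in f) => //; exfalso.
have h3 := vedge_in hf h2.
case: hf (hf) => _ _ _ _ _ hR hf.
apply: (hR (y%:Z, y) (y.-1%:Z, y.-1)).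
- by rewrite mem_Rset eqxx; lia.
- by rewrite mem_Rset eqxx; lia.
- by rewrite xpair_eqE; lia.
apply/conn_path; apply: (@conn_trans _ _ (y%:Z - 1, y)); apply: conn_sym.
  by rewrite -[X in conn _ _ _ (X, _)](subrK 1); apply: conn_hedge.
have := conn_vedge hf _ h2; rewrite prednK; last by lia.
by rewrite (_ : y.-1%:Z = y%:Z - 1); [apply|]; lia.
Qed.

(** Thus a path at the vertex either passes from one odd square to the other or turns inside a
    single one. On the left boundary the upper side is the inserted edge; in column [y - 1] the
    upper side is unchanged and at most 1; elsewhere both sides go from [d] to [2 - d]. *)
Lemma gyr_sides N f (x : int) (y : nat) : tfpl N f -> (0 < y <= N)%N -> - y%:Z <= x < y%:Z ->
  [\/ side (gyr N f) (x, y) false = 1%N /\ side (gyr N f) (x, y) true = 1%N,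
      side (gyr N f) (x, y) false = 0%N /\ side (gyr N f) (x, y) true <> 1%N
    | side (gyr N f) (x, y) true = 0%N /\ side (gyr N f) (x, y) false <> 1%N].
Proof.
move=> hf hy hx; have lo := side_lower hf hy hx.
have hy0 : (0 < (x, y).2)%N by rewrite /=; lia.
case: (eqVneq x (- y%:Z)) lo => [->|hxL] lo.
  have := degree_side f (w := (- y%:Z, y)) hy0; rewrite (side_L hf hy) => d.
  move: (degree_L_le1 hf hy) (side_upper_L hf hy); rewrite d addn0; move: lo.
  case: (side f _ _) => [|[|]] //= lo _ ->; [by constructor 3; split; lia|by constructor 1; split;
    lia].
case: (eqVneq x (y%:Z - 1)) lo hxL hx => [->|hxR] lo hxL hx.
  have hy1 : - y%:Z < y%:Z - 1 < y%:Z by lia.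
  have := degree_inner hf hy hy1; rewrite degree_side // => d.
  have := side_R_le1 hf hy; have := side_upper_R N f (y := y) hy0 => E b.
  move: (side (gyr _ _) _ true) E d lo => u ->.
  case: (side f _ true) b => [|[|]] // _ d lo; [by constructor 3; split; lia|by constructor 1;
    split; lia].
have hx' : - y%:Z < x < y%:Z by lia.
have := degree_inner hf hy hx'; rewrite (degree_side f hy0) => d.
have up : (side f (x, y) true + side (gyr N f) (x, y) true = 2)%N by apply: side_upper => //; lia.
case: (side (gyr N f) (x, y) false) lo => [|[|]] lo; [by constructor 2; split;
  lia|by constructor 1; split; lia|by constructor 3; split; lia].
Qed.

(** * Left gyration preserves TFPLs *)

Definition cell_adj (F : config) (c : cell) (i j i' j' : bool) : bool :=
  [&& j == j', i != i' & hedge c.1 (c.2 + j)%N \in F]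
  || [&& i == i', j != j' & vedge (c.1 + (i : nat)%:Z) c.2 \in F].

Lemma cell_adj_contr F c i j i' j' : cell_adj F c i j i' j' ->
  (0 < contr F c i j)%N /\ (0 < contr F c i' j')%N.
Proof.
by rewrite /contr; case/orP=> /and3P[/eqP-> _ ->]; rewrite ?addn1 ?add1n.
Qed.

(* Wieland's local observation, for a cycle of length four with horizontal edges [h] and
   vertical edges [v]: two corners of degree 1 that are joined after gyration ([s] tells
   whether the edges are exchanged) were already joined before. *)
Lemma four_cycle (h v : bool -> bool) (R : bool -> bool -> bool -> bool -> Prop) :
  (forall i j, R i j i j) ->
  (forall i j i' j' i'' j'', R i j i' j' -> R i' j' i'' j'' -> R i j i'' j'') ->
  (forall i j, h j -> R i j (~~ i) j) -> (forall i j, v i -> R i j i (~~ j)) ->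
  let s := ~~ [&& h false == h true, v false == v true & h false != v false] in
  let cg i j := ((h j (+) s) + (v i (+) s))%N in
  forall i j i' j', cg i j = 1%N -> cg i' j' = 1%N ->
  [|| [&& j == j', i != i' & h j (+) s], [&& i == i', j != j' & v i (+) s]
    | [exists k : bool * bool, cg k.1 k.2 == 2%N]] -> R i j i' j'.
Proof.
move=> Rr Rt Rh Rv s cg i j i' j' ci ci' adj.
(* Besides single edges, the case analysis uses walks of two and three edges around the cycle. *)
have Rhv a b : h b -> v (~~ a) -> R a b (~~ a) (~~ b) by move=> ha va; apply:
  Rt (Rh _ _ ha) (Rv _ _ va).
have Rvh a b : v a -> h (~~ b) -> R a b (~~ a) (~~ b) by move=> va hb; apply:
  Rt (Rv _ _ va) (Rh _ _ hb).
have Rhvh a b : h b -> v (~~ a) -> h (~~ b) -> R a b a (~~ b).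
  by move=> h1 v1 h2; have := Rt _ _ _ _ _ _ (Rhv _ _ h1 v1) (Rh (~~ a) _ h2); rewrite negbK.
have Rvhv a b : v a -> h (~~ b) -> v (~~ a) -> R a b (~~ a) b.
  by move=> h1 v1 h2; have := Rt _ _ _ _ _ _ (Rvh _ _ h1 v1) (Rv _ (~~ b) h2); rewrite negbK.
have {}adj : [|| [&& j == j', i != i' & h j (+) s], [&& i == i', j != j' & v i (+) s],
    cg false false == 2%N, cg false true == 2%N, cg true false == 2%N | cg true true == 2%N].
  case/or3P: adj => [->|->|/existsP[[[] []] /= ->]]; by rewrite ?orbT.
move: (Rh i j) (Rv i j) (Rhv i j) (Rvh i j) (Rhvh i j) (Rvhv i j) ci ci' adj; rewrite /cg /s.
case: i; case: j; case: i'; case: j' => /=; try by move=> *; apply: Rr.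
all: case: (h false); case: (h true); case: (v false); case: (v true) => //=; by auto.
Qed.

Lemma cell_conn N f c (i j i' j' : bool) : tfpl N f -> c \in cells N -> odd_cell c ->
  (c.2 + j <= N)%N -> (c.2 + j' <= N)%N ->
  contr (gyr N f) c i j = 1%N -> contr (gyr N f) c i' j' = 1%N ->
  cell_adj (gyr N f) c i j i' j' \/
    (exists k l : bool, (c.2 + l <= N)%N /\ contr (gyr N f) c k l = 2%N) ->
  conn N f (corner c i j) (corner c i' j').
Proof.
case: c => x y hf; rewrite mem_cells /odd_cell /= => hc pc hj hj' ci ci' adj.
case: (ltnP y N) => hy; last first.
  (* After gyration an external odd cell has its left but not its right edge, so its two upper
     corners cannot both have contribution 1: the two given corners coincide. *)
  have yN : y = N by lia.
  have jF (b : bool) : (y + b <= N)%N -> b = false by case: b => //; lia.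
  move: ci ci'; rewrite (jF _ hj) (jF _ hj') /contr /=.
  have l1 : vedge x y \in gyr N f.
    by rewrite yN (@in_gyr_external N f x) ?inE ?eqxx ?orbT ?(vedge_ext hf) //; lia.
  have r0 : vedge (x + 1) y \in gyr N f = false.
    by rewrite yN (@in_gyr_external N f x) ?inE ?eqxx ?orbT ?(vedge_ext hf) //; lia.
  by case: i {adj}; case: i'; rewrite ?addr0 ?l1 ?r0; try (by move=> *; exact: conn_refl); case:
    (_ \in gyr N f).
pose h (b : bool) := hedge x (y + b)%N \in f; pose v (b : bool) := vedge (x + (b : nat)%:Z) y \in f.
have gh (b : bool) : (hedge x (y + b)%N \in gyr N f) = h b (+) ~~ neutral f x y.
  rewrite (@in_gyr_inner N f x y) //; try lia.
  by case: b; rewrite ?addn0 ?addn1 !inE ?eqxx ?orbT.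
have gv (b : bool) : (vedge (x + (b : nat)%:Z) y \in gyr N f) = v b (+) ~~ neutral f x y.
  rewrite (@in_gyr_inner N f x y) //; try lia.
  by case: b; rewrite ?addr0 !inE ?eqxx ?orbT.
have nE : neutral f x y = [&& h false == h true, v false == v true & h false != v false].
  by rewrite /neutral /h /v addn0 addn1 addr0.
apply: (@four_cycle h v (fun i j i' j' => conn N f (corner (x, y) i j) (corner (x, y) i' j'))).
- by move=> *; exact: conn_refl.
- by move=> *; apply: conn_trans; eassumption.
- move=> a b /(conn_hedge hf); rewrite /corner /=; case: a; rewrite addr0 //; exact: conn_sym.
- move=> a b /(conn_vedge hf hy); rewrite /corner /=; case: b; rewrite ?addn0 ?addn1 //; exact:
  conn_sym.
- by rewrite -nE -gh -gv.
- by rewrite -nE -gh -gv.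
rewrite -nE -gh -gv; case: adj => [/orP[-> //|->]|[k [l [_ e]]]]; rewrite ?orbT //.
by apply/orP; right; apply/orP; right; apply/existsP; exists (k, l); rewrite /= -gh -gv; apply/eqP.
Qed.

(** The last cell of each row is even, so odd cells never reach the right boundary. *)
Lemma corner_bounds N c (i j : bool) : c \in cells N -> odd_cell c -> (c.2 + j <= N)%N ->
  (0 < (corner c i j).2 <= N)%N &&
  (- (corner c i j).2%:Z <= (corner c i j).1 < (corner c i j).2%:Z).
Proof. by case: c => x y; rewrite mem_cells /odd_cell /=; case: i; case: j => /=; lia. Qed.

Lemma corner_inj c c' (i i' j : bool) : odd_cell c -> odd_cell c' ->
  corner c i j = corner c' i' j -> c = c' /\ i = i'.
Proof.
case: c c' => x y [x' y']; rewrite /odd_cell /corner /= => pc pc' [e1 /eqP].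
rewrite eqn_add2r => /eqP e2; rewrite e2 in pc e1 *.
have ii : i = i' by move: pc pc' e1; case: i; case: i' => /=; lia.
by split=> //; congr (_, _); rewrite ii in e1; lia.
Qed.

Lemma cell_adj_sym F c (i j i' j' : bool) : cell_adj F c i j i' j' = cell_adj F c i' j' i j.
Proof.
rewrite /cell_adj [j == _]eq_sym [i == _]eq_sym [i' == i]eq_sym.
by case: eqP => [->|_]; case: eqP => [->|_]; rewrite ?eqxx //= eq_sym.
Qed.

(** * Tracing paths of the gyrated configuration back in [f] *)

Definition joins (e : edge) (u v : point) : bool :=
  ((u == fst_end e) && (v == snd_end e)) || ((v == fst_end e) && (u == snd_end e)).

(* The vertices, inserted ones included, that survive the deletion, before the shift. *)
Definition live (N : nat) (w : point) : bool :=
  (0 < w.2 <= N)%N && (- w.2%:Z - 1 <= w.1 < w.2%:Z).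

Definition gyr_adj (N : nat) (f : config) (u v : point) : Prop :=
  [/\ live N u, live N v & exists2 e, e \in gyr N f & joins e u v].

Lemma WL_adjacent N f u v : adjacent N (WL N f) u v ->
  gyr_adj N f (u.1 - 1, u.2) (v.1 - 1, v.2).
Proof.
case: u v => [x y] [x' y'] /and3P[]; rewrite !vertP => hu hv /hasP[[b [s t]] he hj].
split; rewrite /live /=; [lia|lia|exists (b, (s - 1, t))].
  by have := in_WL N f (b, (s - 1, t)); rewrite /= subrK he => /esym/and3P[].
move: hj; rewrite /joins /fst_end /snd_end /= => hj.
by case: b {he} hj; rewrite /= !xpair_eqE; lia.
Qed.

(* The vertices L_i' and L_i of row [y]. *)
Definition Lnew (y : nat) : point := (- y%:Z - 1, y).
Definition Lold (y : nat) : point := (- y%:Z, y).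

(** Every grid edge bounds one odd square, and for an edge between live vertices this square is a
    cell unless the edge is an inserted one. *)
Lemma gyr_adj_cases N f u v : tfpl N f -> gyr_adj N f u v ->
  (exists y, [/\ (0 < y <= N)%N, hedge (- y%:Z - 1) y \in gyr N f
     & (u, v) = (Lnew y, Lold y) \/ (u, v) = (Lold y, Lnew y)])
  \/ (exists c (i j i' j' : bool),
      [/\ c \in cells N /\ odd_cell c, (c.2 + j <= N)%N /\ (c.2 + j' <= N)%N,
          u = corner c i j, v = corner c i' j' & cell_adj (gyr N f) c i j i' j']).
Proof.
move=> hf [lu lv [[b [x y]] he hj]].
(* The claim is symmetric in [u] and [v], so the edge may be oriented. *)
wlog [hu hv] : u v lu lv {hj} / u = (x, y) /\ v = snd_end (b, (x, y)).
  move=> W; case/orP: hj => /andP[/eqP h1 /eqP h2]; first by apply: W.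
  case: (W v u) => // [[y' [h3 h4 h5]]|[c [i [j [i' [j' [h3 [h4 h4'] h5 h6 h7]]]]]]].
    by left; exists y'; split=> //; by case: h5 => -[-> ->]; [right|left].
  by right; exists c, i', j', i, j; split=> //; rewrite cell_adj_sym.
subst u v; case: b he lu lv => he; rewrite /live /snd_end /= => lu lv.
  have hb := gyr_vedge_in hf he; right.
  case: (boolP (odd (absz (x + y%:Z)))) => px.
    exists (x - 1, y), true, false, true, true; split=> /=.
    - by rewrite mem_cells /odd_cell /=; split; lia.
    - by split; lia.
    - by rewrite /corner /= subrK addn0.
    - by rewrite /corner /= subrK addn1.
    - by rewrite /cell_adj /= subrK; exact: he.
  exists (x, y), false, false, false, true; split=> /=.
  - by rewrite mem_cells /odd_cell /=; split; lia.
  - by split; lia.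
  - by rewrite /corner /= addr0 addn0.
  - by rewrite /corner /= addr0 addn1.
  - by rewrite /cell_adj /= addr0; exact: he.
case: (eqVneq x (- y%:Z - 1)) => hx.
  left; exists y; split; [lia|by rewrite -hx|left].
  by rewrite hx /Lnew /Lold subrK.
right; case: (boolP (odd (absz (x + y%:Z)))) => px.
  exists (x, y.-1), false, true, true, true; split=> /=.
  - by rewrite mem_cells /odd_cell /=; split; lia.
  - by split; lia.
  - by rewrite /corner /= addr0 addn1 prednK //; lia.
  - by rewrite /corner /= addn1 prednK //; lia.
  - by rewrite /cell_adj /= addn1 prednK ?orbF; [exact: he|lia].
exists (x, y), false, false, true, false; split=> /=.
- by rewrite mem_cells /odd_cell /=; split; lia.
- by split; lia.
- by rewrite /corner /= addr0 addn0.
- by rewrite /corner /= addn0.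
- by rewrite /cell_adj /= addn0 orbF; exact: he.
Qed.

(* A path of [gyr N f] may leave the corresponding path of [f] at a vertex whose two edges lie
   in one odd cell; there it is represented by an end [r] of the segment inside that cell, which
   lies on both paths. *)
Definition rep (N : nat) (f : config) (w r : point) : Prop :=
  [\/ [/\ r = w, side (gyr N f) w false = 1%N & side (gyr N f) w true = 1%N],
      exists c (i j i' j' : bool),
        [/\ c \in cells N /\ odd_cell c, (c.2 + j <= N)%N /\ (c.2 + j' <= N)%N,
            w = corner c i j, r = corner c i' j'
          & contr (gyr N f) c i j = 2%N /\ contr (gyr N f) c i' j' = 1%N]
    | exists y, [/\ (0 < y <= N)%N, hedge (- y%:Z - 1) y \in gyr N f, w = Lnew y & r = Lold y]].

Lemma Lold_sides N f y (j : bool) : tfpl N f -> (0 < y <= N)%N ->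
  hedge (- y%:Z - 1) y \in gyr N f ->
  side (gyr N f) (Lold y) j = 1%N.
Proof.
move=> hf hy; rewrite in_gyr_L // => d1; case: j; first by rewrite side_upper_L // d1.
move: d1; rewrite degree_side /=; last by lia.
rewrite (side_L hf hy) addn0 => /eqP d1.
by have := @side_lower N f (- y%:Z) y hf hy; rewrite d1 => H; have := H ltac:(lia); case.
Qed.

(** This rules out the first case of [rep] at an inserted vertex, which must be represented by its
    right neighbour. *)
Lemma Lnew_side N f y : tfpl N f -> side (gyr N f) (Lnew y) false = 0%N.
Proof.
move=> hf; rewrite /side /contr /side_cell /= (_ : odd _ = true); last by lia.
rewrite subn0 addn0 /=; apply/eqP; rewrite addn_eq0 !eqb0.
apply/andP; split; apply/negP; [move/(gyr_hedge_in hf)|move/(gyr_vedge_in hf)]; lia.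
Qed.

Lemma corner_Lnew N c (i j : bool) y : c \in cells N -> odd_cell c -> (c.2 + j <= N)%N ->
  Lnew y <> corner c i j.
Proof. by move=> hc oc hj e; have := corner_bounds i hc oc hj; rewrite -e /Lnew /=; lia. Qed.

Lemma gyr_corner_sides N f c (i j : bool) : tfpl N f -> c \in cells N -> odd_cell c ->
  (c.2 + j <= N)%N ->
  forall k, (contr (gyr N f) c i j = 1%N -> side (gyr N f) (corner c i j) k = 1%N)
   /\ (contr (gyr N f) c i j = 2%N -> k != j -> side (gyr N f) (corner c i j) k = 0%N).
Proof.
move=> hf hc oc hj k; have := corner_bounds i hc oc hj.
rewrite -(side_corner (gyr N f) i j oc); case: (corner c i j) => x y /= /andP[hy hx].
by case: (gyr_sides hf hy hx) => -[e0 e1]; case: j {hj}; case: k; split=> //=; congruence.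
Qed.

Lemma gyr_contr_le2 F c (i j : bool) : (contr F c i j <= 2)%N.
Proof. by rewrite /contr; do 2!case: (_ \in F). Qed.

(** Along an inserted edge the representative stays at L_y. Inside an odd cell it waits while the
    path visits corners of contribution 2, and crosses the cell by [cell_conn] when the path reaches
    a corner of contribution 1. *)
Lemma rep_step N f w w' r : tfpl N f -> rep N f w r -> gyr_adj N f w w' ->
  exists2 r', rep N f w' r' & conn N f r r'.
Proof.
move=> hf hr /(gyr_adj_cases hf).
case=> [[y [hy he [[ew ew']|[ew ew']]]]|[c [i [j [i' [j' [[hc oc] [hj hj'] ew ew' hadj]]]]]]];
  subst w w'.
- exists (Lold y); first by constructor 1; split=> //; exact: Lold_sides.
  case: hr => [[_]|[c [i [j [i' [j' [[hc oc] [hj _] ew]]]]]]|[y' [_ _ [_ <-] ->]]].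
  + by rewrite Lnew_side.
  + by case: (corner_Lnew hc oc hj ew).
  + exact: conn_refl.
- exists (Lold y); first by constructor 3; exists y.
  case: hr => [[-> _ _]|[c [i [j [i' [j' [[hc oc] [hj _] ew _ [c2 _]]]]]]]|[y' [_ _ [e1 e2] _]]].
  + exact: conn_refl.
  + by have := side_corner (gyr N f) i j oc; rewrite -ew c2 Lold_sides.
  + by exfalso; rewrite e2 in e1; lia.
have [c1 c1'] := cell_adj_contr hadj; have le2 := gyr_contr_le2 (gyr N f) c i' j'.
case: hr => [[-> s0 s1]|[c2 [k [l [k' [l' [[hc2 oc2] [hl hl'] ew er [x2 x1]]]]]]]|[y [_ _ e1 _]]];
  last first.
- by case: (corner_Lnew hc oc hj (esym e1)).
(* A vertex with both edges in one odd cell has none in the opposite one, so the next edge stays in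
   the same cell. *)
- have lj : l = j.
    apply/eqP; rewrite eq_sym; apply: contraLR c1 => nl; rewrite -(side_corner _ i j oc) ew.
    by rewrite (gyr_corner_sides k hf hc2 oc2 hl j).2.
  subst l r; have [? ?] := corner_inj oc oc2 ew; subst c2 k.
  case: (ltnP 1 (contr (gyr N f) c i' j')) => c2'.
    exists (corner c k' l'); last exact: conn_refl.
    by constructor 2; exists c, i', j', k', l'; do !split=> //; lia.
  have e1 : contr (gyr N f) c i' j' = 1%N by lia.
  exists (corner c i' j').
    by constructor 1; split=> //; apply: (gyr_corner_sides i' hf hc oc hj' _).1.
  by apply: (cell_conn hf) => //; right; exists i, j.
(* The path enters the cell at [w], which represents itself and stays the representative if the next
   corner has contribution 2. *)
have e1 : contr (gyr N f) c i j = 1%N by rewrite -side_corner //; case: j {hadj hj c1} s0 s1.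
case: (ltnP 1 (contr (gyr N f) c i' j')) => c2'.
  exists (corner c i j); last exact: conn_refl.
  by constructor 2; exists c, i', j', i, j; do !split=> //; lia.
have e1' : contr (gyr N f) c i' j' = 1%N by lia.
exists (corner c i' j').
  by constructor 1; split=> //; apply: (gyr_corner_sides i' hf hc oc hj' _).1.
by apply: (cell_conn hf) => //; left.
Qed.

Lemma rep_path N f u p r : tfpl N f -> path (adjacent N (WL N f)) u p -> rep N f (u.1 - 1, u.2) r ->
  exists2 r', rep N f ((last u p).1 - 1, (last u p).2) r' & conn N f r r'.
Proof.
move=> hf; elim: p u r => [|v p IH] u r /=; first by exists r => //; exact: conn_refl.
case/andP=> /WL_adjacent huv hp hr; have [r1 h1 c1] := rep_step hf hr huv.
by have [r2 h2 c2] := IH _ _ hp h1; exists r2 => //; exact: conn_trans c1 c2.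
Qed.

Lemma in_WL_hB N f (x : int) (y : nat) : (hedge x y \in WL N f) =
  (hedge (x - 1) y \in gyr N f) && ~~ ((0 < y <= N)%N && ((x - 1 == y%:Z) || (x == y%:Z))).
Proof. by rewrite -[in LHS](subrK 1 x) in_WL_h subrK. Qed.

Lemma in_WL_vB N f (x : int) (y : nat) : (vedge x y \in WL N f) =
  (vedge (x - 1) y \in gyr N f)
  && ~~ ((0 < y <= N)%N && (x - 1 == y%:Z) || (y < N)%N && (x - 1 == y.+1%:Z)).
Proof. by rewrite -[in LHS](subrK 1 x) in_WL_v. Qed.

Lemma WL_degree N f (x : int) (y : nat) : (0 < y <= N)%N -> x < y%:Z ->
  degree (WL N f) (x, y) = degree (gyr N f) (x - 1, y).
Proof.
move=> hy hx; rewrite !degreeE; [|lia|lia].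
have hE x' : x' < y%:Z -> (hedge x' y \in WL N f) = (hedge (x' - 1) y \in gyr N f).
  by move=> hx'; rewrite in_WL_hB; lia.
have vE z : x <= z%:Z -> (vedge x z \in WL N f) = (vedge (x - 1) z \in gyr N f).
  by move=> hz; rewrite in_WL_vB; lia.
by rewrite !hE ?vE //; lia.
Qed.

(** The new R_y is the old [(y - 1, y)]. The deletion removes its edges to R_y and to the right end
    of the row above, which leaves the two edges in the odd square below. *)
Lemma WL_degree_R N f (y : nat) : tfpl N f -> (0 < y <= N)%N ->
  degree (WL N f) (y%:Z, y) = side (gyr N f) (y%:Z - 1, y) false.
Proof.
move=> hf hy; rewrite degreeE; last by lia.
have -> : (hedge y%:Z y \in WL N f) = false by rewrite in_WL_hB; lia.
have -> : (vedge y%:Z y.-1 \in WL N f) = false.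
  by apply/negP; rewrite in_WL_vB => /andP[/(gyr_vedge_in hf)]; lia.
have -> : (hedge (y%:Z - 1) y \in WL N f) = (hedge (y%:Z - 1 - 1) y \in gyr N f) by rewrite in_WL_hB; lia.
have -> : (vedge y%:Z y \in WL N f) = (vedge (y%:Z - 1) y \in gyr N f) by rewrite in_WL_vB; lia.
rewrite /side /contr /side_cell /= (_ : odd _ = true) /=; last by lia.
by rewrite subn0 addn0 subrK addn0.
Qed.

Lemma WL_degree_new N f (y : nat) : tfpl N f -> (0 < y <= N)%N -> (degree (WL N f) ((- y%:Z)%R,
  y) <= 1)%N.
Proof.
move=> hf hy; rewrite degreeE; last by lia.
have nh x : x < - y%:Z -> hedge x y \in WL N f = false.
  by move=> hx; apply/negP; rewrite in_WL_hB => /andP[/(gyr_hedge_in hf)]; lia.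
have nv x z : x <= - z%:Z -> vedge x z \in WL N f = false.
  by move=> hx; apply/negP; rewrite in_WL_vB => /andP[/(gyr_vedge_in hf)]; lia.
rewrite [X in (_ + X + _ + _)%N](_ : _ = 0%N) ?nv; [by case: (_ \in _)|lia|lia|].
by rewrite nh //; lia.
Qed.

Lemma corner_R N c (i j : bool) y : c \in cells N -> odd_cell c ->
  ((y%:Z - 1)%R : int, y) = corner c i j -> j = false.
Proof.
case: c => x z; rewrite mem_cells /odd_cell /corner /= => hc oc [e1 e2].
by case: i e1; case: j e2 => //=; lia.
Qed.

Lemma tfpl_WL N f : tfpl N f -> tfpl N (WL N f).
Proof.
move=> hf; split.
- move=> [[] [x y]]; rewrite /is_edge /is_external /fst_end /snd_end /= !vertP.
    by rewrite in_WL_vB => /andP[/(gyr_vedge_in hf)]; lia.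
  by rewrite in_WL_hB => /andP[/(gyr_hedge_in hf)]; lia.
- move=> k hk; case: (posnP N) => [N0|N0].
    have -> : k = 0%N by lia.
    by apply/negP; rewrite in_WL_vB => /andP[/(gyr_vedge_in hf)]; lia.
  rewrite in_WL_vB (_ : ~~ _ = true) ?andbT; last by lia.
  case: k hk => [|k] hk; first by apply/negP => /(gyr_vedge_in hf); lia.
  (* Before the shift this was the external edge number [k], and gyration has complemented it. *)
  set x : int := k.+1%:Z - N%:Z - 1.
  have -> : (vedge x N \in gyr N f) = ~~ (vedge x N \in f).
    case: (boolP (odd (absz (x + N%:Z)))) => px.
      by rewrite (@in_gyr_external N f (x - 1)) // ?subrK ?inE ?eqxx ?orbT //; lia.
    by rewrite (@in_gyr_external N f x) // ?inE ?eqxx ?orbT //; lia.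
  by rewrite (vedge_ext hf); lia.
- move=> [x y]; rewrite inE mem_Lset mem_Rset => /orP[]/andP[hy /eqP->].
    exact: WL_degree_new.
  rewrite (WL_degree_R hf hy).
  have hlo : - y%:Z <= y%:Z - 1 < y%:Z by lia.
  have lo := side_lower hf hy hlo.
  have := side_R_le1 hf hy.
  have hy1 : - y%:Z < y%:Z - 1 < y%:Z by lia.
  have := degree_inner hf hy hy1; rewrite degree_side /=; [|lia].
  by move: lo; lia.
- move=> [x y]; rewrite vertP inE mem_Lset mem_Rset => h1 h2.
  have [hy hx] : (0 < y <= N)%N /\ - y%:Z < x < y%:Z by lia.
  rewrite WL_degree ?degree_side /=; [|lia|lia|lia].
  have hlo : - y%:Z <= x - 1 < y%:Z by lia.
  have lo := side_lower hf hy hlo.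
  case: (eqVneq (x - 1) (- y%:Z)) => hxL.
    move: lo (degree_L_le1 hf hy); rewrite hxL side_upper_L // degree_side /=; last by lia.
    by rewrite (side_L hf hy) addn0; case: (side f _ _) => [|[|n]] /=; rewrite ?add0n ?add1n;
      [move=> -> | case=> -> | ].
  have hx1 : - y%:Z < x - 1 < y%:Z by lia.
  have hx2 : - y%:Z < x - 1 < y%:Z - 1 by lia.
  have up := side_upper hf hy hx2.
  have := degree_inner hf hy hx1; rewrite degree_side /=; [|lia].
  change (2 : nat) with 2%N; lia.
- move=> [x y] [x' y']; rewrite !mem_Lset =>
  /andP[hy /eqP->] /andP[hy' /eqP->] ne /conn_path[p hp hl].
  (* The ends differ, so the walk has a first edge. It leaves an inserted vertex and hence is the
     inserted edge, so L_y is a representative. *)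
  have [v hv] : exists v, gyr_adj N f (Lnew y) v.
    case: p hp hl => [_ /= e|v p /= /andP[/WL_adjacent ha _] _]; first by rewrite e eqxx in ne.
    by exists (v.1 - 1, v.2).
  have rL : rep N f (Lnew y) (Lold y).
    constructor 3; exists y; split=> //.
    case: (gyr_adj_cases hf hv) =>
      [[z [hz he [[e _]|[e e' _]]]]|[c [i [j [i' [j' [[hc oc] [hj _] e _ _]]]]]]].
    + by move: he; rewrite (_ : y = z) //; lia.
    + by exfalso; rewrite e' in e; lia.
    + by case: (corner_Lnew hc oc hj e).
  have [r hr cr] := rep_path hf hp rL; rewrite hl in hr.
  case: hf (hf) => _ _ _ _ iv _ hf; apply: (iv (Lold y) (Lold y') _ _ ne).
  + by rewrite mem_Lset hy eqxx.
  + by rewrite mem_Lset hy' eqxx.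
  apply/conn_path; case: hr cr =>
    [[_]|[c [i [j [i' [j' [[hc oc] [hj _] e]]]]]]|[z [hz _ [_ ->] ->]]] //.
  + by rewrite (Lnew_side _ hf).
  + by case: (corner_Lnew hc oc hj e).
- move=> [x y] [x' y']; rewrite !mem_Rset =>
  /andP[hy /eqP->] /andP[hy' /eqP->] ne /conn_path[p hp hl].
  have hv1 z : (0 < z <= N)%N -> - z%:Z <= z%:Z - 1 < z%:Z by lia.
  have hv2 z : (0 < z <= N)%N -> - z%:Z < z%:Z - 1 < z%:Z by lia.
  (* The only upper edge at [(z - 1, z)] prolongs a path of [f] to the right boundary, in row [z] or
     in row [z.-1]. *)
  have key z : (0 < z <= N)%N -> side f (z%:Z - 1, z) true = 1%N ->
      conn N f (z%:Z - 1, z) (z%:Z, z) /\ hedge (z%:Z - 1) z \in f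
      \/ conn N f (z%:Z - 1, z) (z.-1%:Z, z.-1) /\ vedge z.-1%:Z z.-1 \in f.
    move=> hz; rewrite side_upper_RE; last by lia.
    case h1: (hedge _ _ \in f) => /= h2.
      by left; split=> //; rewrite -[X in conn _ _ _ (X, _)](subrK 1); exact: conn_hedge.
    have {}h2 : vedge z.-1%:Z z.-1 \in f by move: h2; case: (_ \in f).
    right; split=> //; apply: conn_sym; rewrite (_ : z%:Z - 1 = z.-1%:Z); last by lia.
    by have := conn_vedge hf _ h2; rewrite prednK; [apply|]; lia.
  have deg z : (0 < z <= N)%N -> ((hedge (z%:Z - 1) z \in f) + (vedge z%:Z z \in f) <= 1)%N.
    move=> hz; have : (degree f (z%:Z, z) <= 1)%N.
      by case: hf => _ _ h _ _ _; apply: h; rewrite inE mem_Rset hz eqxx orbT.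
    rewrite degreeE; lia.
  have fin a b : (0 < a <= N)%N -> (0 < b <= N)%N -> conn N f (a%:Z, a) (b%:Z, b) -> a = b.
    move=> ha hb /conn_path hc; apply/eqP; case: eqP => // hab; case: hf => _ _ _ _ _ iv.
    case: (iv (a%:Z, a) (b%:Z, b)) => //; rewrite ?mem_Rset ?ha ?hb ?eqxx //.
    by rewrite xpair_eqE; apply/negP => /andP[_ /eqP].
  have sides z : (0 < z <= N)%N -> (0 < side (gyr N f) ((z%:Z - 1)%R, z) false)%N ->
      [/\ side (gyr N f) (z%:Z - 1, z) false = 1%N, side (gyr N f) (z%:Z - 1, z) true = 1%N
        & side f (z%:Z - 1, z) true = 1%N].
    move=> hz; rewrite side_upper_R; last by lia.
    have := side_lower hf hz (hv1 z hz); have := degree_inner hf hz (hv2 z hz).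
    have := side_R_le1 hf hz; rewrite degree_side /=; last by lia.
    by move=> *; split; lia.
  have [v hv] : exists v, gyr_adj N f (y%:Z - 1, y) v.
    case: p hp hl => [_ /= e|v p /= /andP[/WL_adjacent ha _] _]; first by rewrite e eqxx in ne.
    by exists (v.1 - 1, v.2).
  have pos : (0 < side (gyr N f) ((y%:Z - 1)%R, y) false)%N.
    case: (gyr_adj_cases hf hv) =>
      [[z [hz he [[e e' _]|[e e' _]]]]|[c [i [j [i' [j' [[hc oc] _ e _ ha]]]]]]].
    + by exfalso; lia.
    + by exfalso; lia.
    + have ej := corner_R hc oc e; rewrite ej in e ha; rewrite e side_corner //.
      exact: (cell_adj_contr ha).1.
  have [g0 g1 f1] := sides y hy pos.
  have rR : rep N f (y%:Z - 1, y) (y%:Z - 1, y) by constructor 1.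
  have [r hr cr] := rep_path hf hp rR; rewrite hl /= in hr.
  have [f1' er] : side f (y'%:Z - 1, y') true = 1%N /\ r = (y'%:Z - 1, y').
    case: hr => [[-> g0' _]|[c [i [j [i' [j' [[hc oc] _ e _ [c2 _]]]]]]]|[z [hz _ [e e'] _]]].
    + by have [] := sides y' hy'; rewrite ?g0'.
    + have ej := corner_R hc oc e; rewrite ej in e c2.
      by have [] := sides y' hy'; rewrite e side_corner // c2.
    + by exfalso; lia.
  subst r.
  have deg2 z : (0 < z <= N)%N -> hedge (z%:Z - 1) z \in f -> vedge z%:Z z \in f -> False.
    by move=> hz h1 h2; move: (deg z hz); rewrite h1 h2.
  have nyy : y != y' by apply: contraNneq ne => ->.
  (* The prolonged path joins two right boundary vertices of [f], which must coincide. If they are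
     reached in the same way then [y = y']; otherwise the common vertex has both a horizontal and a
     vertical edge, against its degree bound. *)
  case: (key y hy f1) => -[k1 k2]; case: (key y' hy' f1') => -[k3 k4];
    have kk := conn_trans (conn_sym k1) (conn_trans cr k3).
  + by move: nyy; rewrite (fin _ _ _ _ kk) ?eqxx.
  + have b4 := vedge_in hf k4; have e : y = y'.-1 by apply: fin kk => //; lia.
    by apply: (deg2 y) => //; rewrite e.
  + have b2 := vedge_in hf k2; have e : y.-1 = y' by apply: fin kk => //; lia.
    by apply: (deg2 y') => //; rewrite -e.
  + have b2 := vedge_in hf k2; have b4 := vedge_in hf k4.
    by have : y.-1 = y'.-1; [apply: fin kk => //; lia | lia].
Qed.

(** * Stabilization *)

Lemma WL_hedge_L N f y : tfpl N f -> (0 < y <= N)%N ->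
  (hedge (- y%:Z) y \in WL N f) = (degree f (- y%:Z, y) == 1%N).
Proof.
move=> hf hy; rewrite -[X in hedge X _ \in WL _ _](subrK 1) in_WL_h in_gyr_L //.
by rewrite (_ : ~~ _ = true) ?andbT //; lia.
Qed.

Lemma WL_vedge_L N f y : tfpl N f -> (0 < y <= N)%N -> (vedge (- y%:Z) y \in WL N f) = false.
Proof.
move=> hf hy; rewrite -[X in vedge X _ \in WL _ _](subrK 1) in_WL_v.
by apply/negP => /andP[/(gyr_vedge_in hf)]; lia.
Qed.

(** The new L_y is the inserted vertex, whose only possible edge is present exactly when the old L_y
    has degree 1. The left boundary degrees are thus constant in time and anchor the reading of each
    row. *)
Lemma WL_degree_L N f y : tfpl N f -> tfpl N (WL N f) -> (0 < y <= N)%N ->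
  degree (WL N f) (- y%:Z, y) = degree f (- y%:Z, y).
Proof.
move=> hf hf' hy; rewrite (degree_L hf' hy) WL_hedge_L // WL_vedge_L //.
by move: (degree_L_le1 hf hy); case: (degree _ _) => [|[|]].
Qed.

(** The shift carries the left edge of an odd cell to the position of the right edge of the same
    cell. *)
Lemma WL_vedge_left N f (x : int) (y : nat) : (0 < y < N)%N -> - y%:Z <= x < y%:Z ->
  ~~ odd (absz (x + y%:Z)) ->
  (vedge (x + 1) y \in WL N f) = (vedge x y \in f) (+) ~~ neutral f x y.
Proof.
move=> hy hx px; rewrite in_WL_v (@in_gyr_inner N f x y) ?inE ?eqxx ?orbT //.
by rewrite (_ : ~~ (_ || _) = true) ?andbT //; lia.
Qed.

(** The shift carries the right edge to where the next odd cell of the row, if any, has its left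
    edge. *)
Lemma WL_vedge_right N f (x : int) (y : nat) : (0 < y < N)%N -> - y%:Z <= x < y%:Z ->
  ~~ odd (absz (x + y%:Z)) ->
  (vedge (x + 1 + 1) y \in WL N f) = (vedge (x + 1) y \in f) (+) ~~ neutral f x y.
Proof.
move=> hy hx px; rewrite in_WL_v (@in_gyr_inner N f x y) ?inE ?eqxx ?orbT //.
by rewrite (_ : ~~ (_ || _) = true) ?andbT //; lia.
Qed.

(* Reading a row from left to right, each horizontal edge is forced by the degree of its
   left endpoint. *)
Lemma hedge_determined N f g (x : int) (y : nat) : tfpl N f -> tfpl N g ->
  (forall y, (0 < y <= N)%N -> degree f (- y%:Z, y) = degree g (- y%:Z, y)) ->
  (forall x' y', x' <= x -> (vedge x' y' \in f) = (vedge x' y' \in g)) ->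
  (hedge x y \in f) = (hedge x y \in g).
Proof.
move=> hf hg hL hv.
have out x' : ~~ ((0 < y <= N)%N && (- y%:Z <= x' < y%:Z)) ->
  (hedge x' y \in f) = (hedge x' y \in g).
  by move=> h; apply/idP/idP => [/(hedge_in hf)|/(hedge_in hg)]; rewrite (negbTE h).
suff H (n : nat) : - y%:Z + n%:Z <= x ->
  (hedge (- y%:Z + n%:Z) y \in f) = (hedge (- y%:Z + n%:Z) y \in g).
  case: (lerP (- y%:Z) x) => hx; last by apply: out; lia.
  by move: (H (absz (x + y%:Z))); rewrite (_ : - y%:Z + _ = x) ?lexx; [apply|lia].
elim: n => [|n IH] hn.
  rewrite addr0 in hn *.
  case hy: ((0 < y <= N)%N); last by apply: out; rewrite hy.
  by move: (hL y hy); rewrite (degree_L hf hy) (degree_L hg hy) hv //; do 3!case: (_ \in _).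
set x' := - y%:Z + n.+1%:Z in hn *.
have {}IH : (hedge (x' - 1) y \in f) = (hedge (x' - 1) y \in g).
  by rewrite (_ : x' - 1 = - y%:Z + n%:Z); [apply: IH|]; lia.
case hi: ((0 < y <= N)%N && (- y%:Z < x' < y%:Z)); last by apply: out; lia.
case/andP: hi => hy hx'; move: (degree_inner hf hy hx') (degree_inner hg hy hx').
rewrite !degreeE; [|lia|lia].
rewrite IH !hv // => <-.
by do 5!case: (_ \in _).
Qed.

(** If the cell is neutral in [f], its right edge in [g] equals the left one and the cell is neutral
    in [g] too. Otherwise the right edge in [g] is the complement of the left one, so the cell is
    not neutral in [g]. Either way the next step reproduces the right edge. *)
Lemma neutralE f g (x : int) (y : nat) : (hedge x y \in f) = (hedge x y \in g) ->
  (hedge x y.+1 \in f) = (hedge x y.+1 \in g) -> (vedge x y \in f) = (vedge x y \in g) ->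
  (vedge x y \in f) (+) ~~ neutral f x y = (vedge (x + 1) y \in g) ->
  (vedge x y \in g) (+) ~~ neutral g x y = (vedge (x + 1) y \in g).
Proof. by rewrite /neutral => -> -> ->; do 5!case: (_ \in _). Qed.

Section Iterates.
Variables (N : nat) (f : config).
Hypothesis hf : tfpl N f.
Let F t := iter t (WL N) f.

Lemma tfpl_iter_WL t : tfpl N (F t).
Proof. by elim: t => //= t; apply: tfpl_WL. Qed.

Lemma hedge_iter_WL t (x : int) (y : nat) :
  (forall x' y', x' <= x -> (vedge x' y' \in F t.+1) = (vedge x' y' \in F t)) ->
  (hedge x y \in F t.+1) = (hedge x y \in F t).
Proof.
move=> hv; apply: hedge_determined hv; [exact: tfpl_iter_WL|exact: tfpl_iter_WL|].
by move=> y' hy'; rewrite /F iterS; apply: WL_degree_L hy'; [exact: tfpl_iter_WL | exact: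
  (tfpl_iter_WL t.+1)].
Qed.

(** External edges are prescribed, and all other vertical edges outside this range are absent. *)
Lemma vedge_iter_out t (x : int) (y : nat) : ~~ ((0 < y < N)%N && (- y%:Z <= x <= y%:Z)) ->
  (vedge x y \in F t.+1) = (vedge x y \in F t).
Proof.
move=> h; have h1 := tfpl_iter_WL t.+1; have h0 := tfpl_iter_WL t.
case hN: ((y == N) && (- N%:Z <= x <= N%:Z)).
  by case/andP: hN => /eqP-> hx; rewrite (vedge_ext h1) // (vedge_ext h0).
by apply/idP/idP => [/(vedge_in h1)|/(vedge_in h0)] h'; exfalso; lia.
Qed.

Lemma vedge_iter_WL (k t : nat) (x : int) (y : nat) : (k < 2 * N)%N -> (k <= t)%N ->
  x <= k%:Z - N%:Z ->
  (vedge x y \in F t.+1) = (vedge x y \in F t).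
Proof.
elim: k t x y => [|k IH] t x y hk ht hx.
  by apply: vedge_iter_out; lia.
case: (boolP ((0 < y < N)%N && (- y%:Z <= x <= y%:Z))) => [|h]; last exact: vedge_iter_out.
case/andP=> hy hxy; case: (lerP x (k%:Z - N%:Z)) => hxk; first by apply: (IH t); lia.
(* The columns to the left are constant from this smaller [t] on, so two successive steps can be
   compared. *)
case: t ht => // t ht.
have V s x' y' : (t <= s)%N -> x' <= x - 1 -> (vedge x' y' \in F s.+1) = (vedge x' y' \in F s).
  by move=> hs hx'; apply: IH; lia.
have H s x' y' : (t <= s)%N -> x' <= x - 1 -> (hedge x' y' \in F s.+1) = (hedge x' y' \in F s).
  by move=> hs hx'; apply: hedge_iter_WL => x2 y2 hx2; apply: V; lia.
case: (eqVneq x (- y%:Z)) => [->|hxy'].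
  have Z s : (vedge (- y%:Z) y \in F s.+1) = false.
    by rewrite /F iterS; apply: WL_vedge_L (tfpl_iter_WL s) _; lia.
  by rewrite !Z.
(* For odd [x + y] the edge is the right side of an odd cell and the image of its left side. It
   depends on its own former state through [neutral], and [neutralE] shows that it settles. *)
case: (boolP (odd (absz (x + y%:Z)))) => px.
  have E s : (vedge x y \in F s.+1) = (vedge (x - 1) y \in F s) (+) ~~ neutral (F s) (x - 1) y.
    by rewrite /F iterS -[x in LHS](subrK 1) WL_vedge_left //; lia.
  rewrite [LHS]E -{3}(subrK 1 x); apply: (@neutralE (F t)).
  - by rewrite H.
  - by rewrite H.
  - by rewrite V.
  - by rewrite subrK E.
(* For even [x + y] it is the image of the right side of the odd cell two columns back, all of whose
   edges are already constant. *)
have E s : (vedge x y \in F s.+1) = (vedge (x - 1) y \in F s) (+) ~~ neutral (F s) (x - 1 - 1) y.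
  rewrite /F iterS {1}(_ : x = x - 1 - 1 + 1 + 1); last by lia.
  by rewrite WL_vedge_right ?subrK //; lia.
rewrite !E V //; congr (_ (+) ~~ _).
by rewrite /neutral subrK !H ?V //; lia.
Qed.

Lemma WL_iter_stable : (0 < N)%N -> WL N (F (2 * N - 1)) = F (2 * N - 1)%N.
Proof.
move=> hN; rewrite -[LHS]/(F (2 * N - 1).+1).
have V x y : (vedge x y \in F (2 * N - 1).+1) = (vedge x y \in F (2 * N - 1)).
  (* Column [N - 1] is column [k - N] for [k = 2 * N - 1]; further right there are no vertical edges
     in rows above the bottom one. *)
  case: (lerP x (N%:Z - 1)) => hx; first by apply: (@vedge_iter_WL (2 * N - 1)); lia.
  by apply: vedge_iter_out; lia.
by apply/fsetP => -[[] [x y]]; [exact: V|exact: hedge_iter_WL].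
Qed.
End Iterates.

(** * Reflection *)

(** A horizontal edge is named by its left end, which is the image of the former right end; hence
    the extra [- 1]. *)
Definition mirror_edge (e : edge) : edge :=
  if e.1 then vedge (- e.2.1) e.2.2 else hedge (- e.2.1 - 1) e.2.2.
Definition mirror (f : config) : config := [fset mirror_edge e | e in f].
Definition mirror_point (v : point) : point := (- v.1, v.2).
Definition mirror_cell (c : cell) : cell := (- c.1 - 1, c.2).

Lemma mirror_edgeK : involutive mirror_edge.
Proof. by move=> [[] [x y]]; rewrite /mirror_edge /hedge /vedge /=; congr (_, (_, _)); lia. Qed.

Lemma mirror_pointK : involutive mirror_point.
Proof. by move=> [x y]; rewrite /mirror_point /= opprK. Qed.

Lemma mirror_cellK : involutive mirror_cell.
Proof. by move=> [x y]; rewrite /mirror_cell /=; congr (_, _); lia. Qed.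

Lemma in_mirror f e : (e \in mirror f) = (mirror_edge e \in f).
Proof.
apply/imfsetP/idP => [[e' /= h ->]|h]; first by rewrite mirror_edgeK.
by exists (mirror_edge e); rewrite ?mirror_edgeK.
Qed.

Lemma mirrorK : involutive mirror.
Proof. by move=> f; apply/fsetP => e; rewrite !in_mirror mirror_edgeK. Qed.

Lemma mirror_vertex N v : is_vertex N (mirror_point v) = is_vertex N v.
Proof. by case: v => x y; rewrite /mirror_point /= !vertP; lia. Qed.

Lemma mirror_Lset N v : (mirror_point v \in Lset N) = (v \in Rset N).
Proof. by case: v => x y; rewrite /mirror_point /= mem_Lset mem_Rset; lia. Qed.

Lemma mirror_Rset N v : (mirror_point v \in Rset N) = (v \in Lset N).
Proof. by rewrite -mirror_Lset mirror_pointK. Qed.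

Lemma mirror_ends e :
  if e.1 then fst_end (mirror_edge e) = mirror_point (fst_end e) /\
              snd_end (mirror_edge e) = mirror_point (snd_end e)
  else fst_end (mirror_edge e) = mirror_point (snd_end e) /\
       snd_end (mirror_edge e) = mirror_point (fst_end e).
Proof.
case: e => [[] [x y]]; split=> //; rewrite /fst_end /snd_end /mirror_point /=; congr (_, _); lia.
Qed.

Lemma mirror_incident v e : incident (mirror_point v) (mirror_edge e) = incident v e.
Proof.
have := mirror_ends e; rewrite /incident.
by case: (e.1) => -[-> ->]; rewrite !(inj_eq (inv_inj mirror_pointK)) // orbC.
Qed.

Lemma mirror_degree f v : degree (mirror f) (mirror_point v) = degree f v.
Proof.
rewrite /degree; set A := [fset e in f | incident v e].
rewrite (_ : [fset e in _ | _] = mirror_edge @` A); last first.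
  apply/fsetP => e; rewrite -[in RHS](mirror_edgeK e) (mem_imfset _ _ (inv_inj mirror_edgeK)) /=.
  by rewrite !inE in_mirror -(mirror_incident v) mirror_edgeK.
by rewrite card_imfset //; exact: inv_inj mirror_edgeK.
Qed.

Lemma mirror_joins e u v :
  joins (mirror_edge e) (mirror_point u) (mirror_point v) = joins e u v.
Proof.
have := mirror_ends e; rewrite /joins.
by case: (e.1) => -[-> ->]; rewrite !(inj_eq (inv_inj mirror_pointK)) //; do 4!case: (_ == _).
Qed.

Lemma mirror_adjacent N f u v :
  adjacent N (mirror f) (mirror_point u) (mirror_point v) = adjacent N f u v.
Proof.
rewrite /adjacent !mirror_vertex; congr [&& _, _ & _].
apply/hasP/hasP => -[e he h]; exists (mirror_edge e).
- by rewrite -in_mirror.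
- by rewrite -[_ || _]/(joins _ u v) -mirror_joins mirror_edgeK.
- by rewrite in_mirror mirror_edgeK.
- by rewrite -[_ || _]/(joins _ (mirror_point u) (mirror_point v)) mirror_joins.
Qed.

Lemma mirror_conn N f u v :
  connected_by_path N (mirror f) u v -> connected_by_path N f (mirror_point u) (mirror_point v).
Proof.
case=> p [hp up hl]; exists (map mirror_point p); split.
- rewrite path_map; apply: sub_path hp => a b /=.
  by rewrite -(mirror_adjacent N f) !mirror_pointK.
- by rewrite -map_cons map_inj_uniq //; exact: inv_inj mirror_pointK.
- by rewrite last_map hl.
Qed.

Lemma mirror_tfpl N f : tfpl N f -> tfpl N (mirror f).
Proof.
move=> hf; case: (hf) => h1 h2 h3 h4 h5 h6; split.
- move=> [[] [x y]]; rewrite in_mirror /mirror_edge /= /is_edge /is_external /fst_end /snd_end /= !vertP.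
    by move/(vedge_in hf); lia.
  by move/(hedge_in hf); lia.
- move=> k hk; rewrite in_mirror /mirror_edge /= (vedge_ext hf); lia.
- move=> v; rewrite -(mirror_pointK v); move: (mirror_point v) => {}v.
  rewrite mirror_degree inE mirror_Lset mirror_Rset orbC => hv.
  by apply: h3; rewrite inE.
- move=> v; rewrite -(mirror_pointK v); move: (mirror_point v) => {}v.
  rewrite mirror_degree mirror_vertex inE mirror_Lset mirror_Rset orbC.
  by move=> hv hv'; apply: h4; rewrite ?inE.
- move=> u v; rewrite -mirror_Rset -(mirror_Rset N v) => hu hv ne /mirror_conn.
  by apply: h6; rewrite ?(inj_eq (inv_inj mirror_pointK)).
- move=> u v; rewrite -mirror_Lset -(mirror_Lset N v) => hu hv ne /mirror_conn.
  by apply: h5; rewrite ?(inj_eq (inv_inj mirror_pointK)).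
Qed.

Lemma mirror_insert N f : mirror (insert_left N (mirror f)) = insert_right N f.
Proof.
apply/fsetP => e; rewrite in_mirror !inE -in_mirror mirrorK; congr (_ || _).
apply/imfsetP/imfsetP => /= -[v]; rewrite !inE => /andP[hv hd] he;
  (exists (mirror_point v); first by
    rewrite !inE ?mirror_Rset ?mirror_Lset hv -1?mirror_degree ?mirror_pointK ?mirrorK).
- by rewrite -[e]mirror_edgeK he /mirror_edge /hedge /=; congr (_, (_, _)); lia.
- by rewrite he /mirror_edge /hedge /=; congr (_, (_, _)); lia.
Qed.

Lemma mirror_delete N f : mirror (delete_vertices (Rset N) f) = delete_vertices (Lset N) (mirror f).
Proof.
apply/fsetP => e; rewrite in_mirror !inE in_mirror; congr (_ && _).
rewrite -(mirror_Rset N (fst_end e)) -(mirror_Rset N (snd_end e)).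
by have := mirror_ends e; case: (e.1) => -[-> ->] //; rewrite andbC.
Qed.

Lemma mirror_shift d f : mirror (shift d f) = shift (- d) (mirror f).
Proof.
apply/fsetP => -[b [x y]]; rewrite in_mirror in_shift in_mirror /mirror_edge /hedge /vedge /=.
case: b; rewrite in_shift; congr (_ \in f); congr (_, (_, _)); lia.
Qed.

Lemma mirror_cell_edges N c e :
  (mirror_edge e \in cell_edges N (mirror_cell c)) = (e \in cell_edges N c).
Proof.
case: c e => x y [b [u v]]; rewrite !in_cell_edges /mirror_cell /mirror_edge.
rewrite /top_edge /bottom_edge /left_edge /right_edge /hedge /vedge.
by case: b; rewrite /= !xpair_eqE /=; lia.
Qed.

Lemma mirror_opposite N f c :
  opposite_sides N (mirror f) (mirror_cell c) = opposite_sides N f c.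
Proof.
rewrite /opposite_sides.
have E (A : config) : (cell_edges N (mirror_cell c) `&` mirror f == mirror A) = (cell_edges N c `&` f == A).
  rewrite -(inj_eq (inv_inj mirrorK)) mirrorK; congr (_ == _).
  by apply/fsetP => e; rewrite in_mirror !inE mirror_cell_edges in_mirror mirror_edgeK.
rewrite -!E; congr (_ || _); congr (_ == _); apply/fsetP => -[b [u v]]; rewrite in_mirror !inE;
  case: c {E} => x y; rewrite /mirror_cell /mirror_edge;
  rewrite /top_edge /bottom_edge /left_edge /right_edge /hedge /vedge;
  by case: b; rewrite /= !xpair_eqE /=; lia.
Qed.

(** The reflection sends a cell in column [x] to column [- x - 1], which changes the parity and so
    exchanges odd and even cells. *)
Lemma mirror_gyrate_all N f :
  mirror (gyrate_all N [seq c <- cells N | odd_cell c] (mirror f)) =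
  gyrate_all N [seq c <- cells N | ~~ odd_cell c] f.
Proof.
apply/fsetP => e; rewrite in_mirror !in_gyrate_all ?filter_uniq ?uniq_cells //.
- rewrite -in_mirror mirrorK; congr (_ (+) _).
  have mc c : c \in cells N -> mirror_cell c \in cells N.
    by case: c => x y; rewrite !mem_cells /=; lia.
  have mo c : odd_cell (mirror_cell c) = ~~ odd_cell c.
    by case: c => x y; rewrite /odd_cell /=; lia.
  apply/hasP/hasP => -[c]; rewrite mem_filter => /andP[oc hc] h; exists (mirror_cell c);
    rewrite ?mem_filter ?mo ?oc ?mc //.
  + by rewrite -(mirror_cell_edges N _ e) mirror_cellK -mirror_opposite mirror_cellK.
  + by rewrite mirror_cell_edges mirror_opposite.
- by move=> c d; rewrite !mem_filter => /andP[+ _] /andP[+ _]; do 2!case: (odd_cell _).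
- by move=> c d; rewrite !mem_filter => /andP[+ _] /andP[+ _]; do 2!case: (odd_cell _).
Qed.

Lemma WR_mirror N f : WR N f = mirror (WL N (mirror f)).
Proof.
rewrite /WL mirror_shift mirror_delete -[insert_left _ _]mirrorK mirror_insert.
by rewrite mirror_gyrate_all.
Qed.

Lemma iter_WR_mirror N f m : iter m (WR N) f = mirror (iter m (WL N) (mirror f)).
Proof. by elim: m => [|m IH]; rewrite ?mirrorK //= IH WR_mirror mirrorK. Qed.

Lemma iter_fixed (T : Type) (F : T -> T) x n m :
  F (iter n F x) = iter n F x -> (n <= m)%N -> iter m F x = iter n F x.
Proof. by move=> h /subnK<-; elim: (m - n)%N => //= k ->. Qed.

Theorem theorem3 (N : nat) (f : config) (hN : (1 <= N)%N) (hf : tfpl N f) :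
  (stable N (iter (2 * N - 1)%N (WL N) f)
   /\ (forall m : nat, (2 * N - 1 <= m)%N ->
         iter m (WL N) f = iter (2 * N - 1)%N (WL N) f))
  /\ (WR N (iter (2 * N - 1)%N (WR N) f) = iter (2 * N - 1)%N (WR N) f
   /\ (forall m : nat, (2 * N - 1 <= m)%N ->
         iter m (WR N) f = iter (2 * N - 1)%N (WR N) f)).
Proof.
have sL := WL_iter_stable hf hN.
have sR : WR N (iter (2 * N - 1)%N (WR N) f) = iter (2 * N - 1)%N (WR N) f.
  by rewrite iter_WR_mirror WR_mirror mirrorK (WL_iter_stable (mirror_tfpl hf) hN).
split; split; [split=> //; exact: tfpl_iter_WL| | exact: sR|]; by move=> m; apply: iter_fixed.
Qed.
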